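(* Let $T$ be the real root of $T^3=T^2+T+1$ (the Tribonacci constant, $T\approx1.83929$). Let $\mathcal F$ be the family of all four-ring instances with radii $1=r_1>t>p>q>0$ (so $r_2=t$, $r_3=p$, $r_4=q$), width $\omega>0$ and planar disk pan of radius $R$, such that: (F1) $R=1+t$; (F2) $p+q\le1-\omega$; (F3) disks of radii $1,p,q$ do not pack in a disk of radius $1+t$. Let $\rho=\max\{t+p+q,\ (p+q)/t,\ q/p\}$. Then every instance of $\mathcal F$ satisfies $\rho>T$ (strictly, for every width $\omega>0$ and all strict radii $q<p<t<1$); moreover $\inf_{\mathcal F}\rho=T$, and this infimum is not attained. Instances of $\mathcal F$ exist only for $t<1/T$. After scaling to $r_1=1$, $\mathcal F$ contains the instance with radii $\{10,5,4.9,4.8\}$, $w=0.3$, $R=15$ and the instance with radii $\{10,5,4.99,4.50\}$, $w=0.505$, $R=15$.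
   Context: Disks of given radii ''pack'' in a disk of radius $R$ if closed disks with these radii can be positioned inside it with pairwise disjoint interiors (tangencies allowed). $\rho$ is the general quantity $\max_i(\sum_{j>i}r_j)/r_i$ for a list of radii $r_1>\dots>r_n$, specialized to four rings. Scaling an instance divides all radii, the width and the pan radius by $r_1$. *)

(* Defs.v *)
From HB Require Import structures.
From mathcomp Require Import all_boot all_order all_algebra.
From mathcomp Require Import all_classical all_reals all_analysis.

Set Implicit Arguments.
Unset Strict Implicit.
Unset Printing Implicit Defensive.

Import Order.TTheory GRing.Theory Num.Theory.
Import numFieldNormedType.Exports.

Local Open Scope classical_set_scope.
Local Open Scope ring_scope.

(* The library norm on [R * R] is the maximum norm, so the Euclidean distance
   is written out; the topology of [R * R] is the usual one. *)
Definition edist (R : realType) (a b : R * R) : R :=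
  Num.sqrt ((a.1 - b.1) ^+ 2 + (a.2 - b.2) ^+ 2).

Definition disk (R : realType) (c : R * R) (r : R) : set (R * R) :=
  [set x | edist c x <= r].

(* The pan is centered at the origin. *)
Definition packs (R : realType) (s : seq R) (rad : R) : Prop :=
  exists c : 'I_(size s) -> R * R,
    (forall i, disk (c i) s`_i `<=` disk (0, 0) rad) /\
    trivIset setT (fun i => interior (disk (c i) s`_i)).

Record four_rings (R : realType) := FourRings {
  r1 : R; r2 : R; r3 : R; r4 : R;
  width : R;
  pan : R }.

Definition scale_rings (R : realType) (I : four_rings R) : four_rings R :=
  FourRings (r1 I / r1 I) (r2 I / r1 I) (r3 I / r1 I) (r4 I / r1 I)
    (width I / r1 I) (pan I / r1 I).

(* max over i of (sum of the r_j, j > i) / r_i; the term i = 4 is an empty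
   sum, hence 0, and is dominated by the others for positive radii. *)
Definition rho (R : realType) (I : four_rings R) : R :=
  Num.max (Num.max ((r2 I + r3 I + r4 I) / r1 I) ((r3 I + r4 I) / r2 I))
    (r4 I / r3 I).

Lemma rho_scaled (R : realType) (t p q w rad : R) :
  rho (FourRings 1 t p q w rad) =
  Num.max (Num.max (t + p + q) ((p + q) / t)) (q / p).
Proof. by rewrite /rho /= divr1. Qed.

Definition four_ring_family (R : realType) : set (four_rings R) :=
  [set I | [/\ r1 I = 1, [/\ r2 I < 1, r3 I < r2 I, r4 I < r3 I & 0 < r4 I],
     0 < width I &
     [/\ pan I = 1 + r2 I,
         r3 I + r4 I <= 1 - width I &
         ~ packs [:: 1; r3 I; r4 I] (1 + r2 I)]]].

(* Main.v *)
Require Import Defs.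
From HB Require Import structures.
From mathcomp Require Import all_boot all_order all_algebra.
From mathcomp Require Import all_classical all_reals all_analysis.
From mathcomp Require Import ring lra.

(** Put the unit disk against the pan, with center at distance [t] from the pan
    center. Two further disks, of radii [p] and [q], have the most room when each
    of them touches both the unit disk and the pan, on opposite sides of the axis
    ([packs_at_corners]). Conversely, when [p] and [q] are not too small, every
    packing has its centers at most as far apart as these two corner positions
    ([clearance_of_packs]). So packing is governed by the sign of one explicit
    expression, [clearance t p q].

    A disk of radius [t] opposite the unit disk leaves room for disks of radius
    [snug t = t (1 + t) / (1 + t + t ^ 2)]. The extremal sum of radii is
    [t + snug t]: any [q <= p <= t] with [p + q <= t + snug t] pack
    ([packs_of_sum_le]). Hence an instance of the family satisfies
    [t + snug t < p + q < 1]. The inequality [t + snug t < 1] says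
    [t ^ 3 + t ^ 2 + t < 1], that is, [t < 1 / T]; and
    [(p + q) / t > (t + snug t) / t], a decreasing function of [t] whose value at
    [1 / T] is [T]. Therefore [rho > T].

    The bound is sharp: for every [t] in the interval from [1 / 2] to [1 / T],
    the values [p] slightly below [t] and [q] slightly below [1 - t] have
    negative clearance ([near_tribonacci_family]), and then
    [rho = (p + q) / t < 1 / t], which tends to [T] as [t] tends to [1 / T]. The
    two numerical instances also have negative clearance. *)

Set Implicit Arguments.
Unset Strict Implicit.
Unset Printing Implicit Defensive.

Import Order.TTheory GRing.Theory Num.Theory.
Import numFieldNormedType.Exports.

Local Open Scope classical_set_scope.
Local Open Scope ring_scope.

(* The analysis library also has an [edist], with extended real values; the
   lemmas below use the prefix [eucl] for the Euclidean distance. *)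
Local Notation eucl := Defs.edist.

(** * Disks in the plane *)

Section EuclideanDistance.
Variable R : realType.
Implicit Types (a b c x y : R * R) (r : R).

Lemma eucl_ge0 a b : 0 <= eucl a b.
Proof. exact: sqrtr_ge0. Qed.

Lemma sqr_eucl a b : eucl a b ^+ 2 = (a.1 - b.1) ^+ 2 + (a.2 - b.2) ^+ 2.
Proof. by rewrite sqr_sqrtr// addr_ge0 ?sqr_ge0. Qed.

Lemma eucl_sym a b : eucl a b = eucl b a.
Proof. by rewrite /Defs.edist -(sqrrN (a.1 - _)) -(sqrrN (a.2 - _)) !opprB. Qed.

Lemma eucl_le a b r : 0 <= r ->
  (eucl a b <= r) = ((a.1 - b.1) ^+ 2 + (a.2 - b.2) ^+ 2 <= r ^+ 2).
Proof. by move=> r0; rewrite -sqr_eucl ler_sqr ?nnegrE ?eucl_ge0. Qed.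

Lemma eucl_ge a b r : 0 <= r ->
  (r <= eucl a b) = (r ^+ 2 <= (a.1 - b.1) ^+ 2 + (a.2 - b.2) ^+ 2).
Proof. by move=> r0; rewrite -sqr_eucl ler_sqr ?nnegrE ?eucl_ge0. Qed.

(** After squaring, this is the Cauchy-Schwarz inequality in the plane, that is
    Lagrange's identity. *)
Lemma eucl_triangle b a c : eucl a c <= eucl a b + eucl b c.
Proof.
rewrite eucl_le ?addr_ge0 ?eucl_ge0// [leRHS]sqrrD !sqr_eucl.
set u := eucl a b; set v := eucl b c.
have cs : (a.1 - b.1) * (b.1 - c.1) + (a.2 - b.2) * (b.2 - c.2) <= u * v.
  rewrite (le_trans (ler_norm _))// -ler_sqr ?nnegrE ?mulr_ge0 ?eucl_ge0//.
  rewrite real_normK ?num_real// exprMn !sqr_eucl.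
  have := sqr_ge0 ((a.1 - b.1) * (b.2 - c.2) - (a.2 - b.2) * (b.1 - c.1)).
  by lra.
by lra.
Qed.

Lemma eucl_point k a b :
  eucl a (a.1 + k * (b.1 - a.1), a.2 + k * (b.2 - a.2)) = `|k| * eucl a b.
Proof.
rewrite -sqrtr_sqr -sqrtrM ?sqr_ge0//; congr Num.sqrt; rewrite /=; ring.
Qed.

Lemma norm_sub_le_eucl a b :
  `|a.1 - b.1| <= eucl a b /\ `|a.2 - b.2| <= eucl a b.
Proof.
by split; rewrite -sqrtr_sqr ler_wsqrtr// ?lerDl ?lerDr sqr_ge0.
Qed.

(** A boundary point [x] is not interior because pushing [x] slightly away from
    the center stays within any box around [x] and leaves the disk; the
    hypothesis on [r] matters here, as the push is along [x - c]. *)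
Lemma interior_diskE c r : 0 < r -> interior (disk c r) = [set x | eucl c x < r].
Proof.
move=> r0; apply/seteqP; split => x /= => [/nbhs_ballP[e /= e0 sub] | xr].
  have xr : eucl c x <= r by apply: sub; exact: ballxx.
  rewrite lt_neqAle xr andbT; apply/eqP => cxr.
  have [d1 d2] := norm_sub_le_eucl c x.
  (* The push moves each coordinate by at most [k * r = e / 2]. *)
  pose k := e / (2 * r).
  have k0 : 0 < k by rewrite divr_gt0 ?mulr_gt0.
  have kr : k * r < e by rewrite (_ : k * r = e / 2); [lra | rewrite /k; field; lra].
  have := sub (c.1 + (1 + k) * (x.1 - c.1), c.2 + (1 + k) * (x.2 - c.2)).
  rewrite /disk /= eucl_point cxr ger0_norm; last lra.
  have small (u v : R) : `|u - v| <= r -> `|v - (u + (1 + k) * (v - u))| < e.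
    move=> uv; rewrite (_ : _ - _ = k * (u - v)); last ring.
    rewrite normrM (gtr0_norm k0); apply: le_lt_trans kr.
    by rewrite ler_wpM2l// ltW.
  have inball : ball x e (c.1 + (1 + k) * (x.1 - c.1), c.2 + (1 + k) * (x.2 - c.2)).
    by split; apply: small; rewrite -cxr.
  by move=> /(_ inball); nra.
pose e := (r - eucl c x) / 2.
have e0 : 0 < e by rewrite /e; lra.
apply/nbhs_ballP; exists e => //=.
move=> y [/= y1 y2]; rewrite /disk /=.
apply: le_trans (eucl_triangle x c y) _.
have : eucl x y <= 2 * e.
  rewrite eucl_le; last by rewrite /e; lra.
  have sq (u v : R) : `|u - v| < e -> (u - v) ^+ 2 <= e ^+ 2.
    by move=> uv; rewrite -real_normK ?num_real// ler_sqr ?nnegrE ?(ltW uv) ?(ltW e0).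
  have := sq _ _ y1; have := sq _ _ y2; have := sqr_ge0 e; lra.
by rewrite /e; lra.
Qed.

(** The point of the small disk farthest from the origin lies on the ray
    through its center; a center at the origin leaves the ray free. *)
Lemma subset_disk c r rad : 0 < r ->
  disk c r `<=` disk (0, 0) rad <-> eucl (0, 0) c + r <= rad.
Proof.
move=> r0; split => [sub | le x cx]; last first.
  by apply: le_trans (eucl_triangle c _ _) _; apply: le_trans le; rewrite lerD2l.
have [c0 | c0] := eqVneq (eucl (0, 0) c) 0.
  have cz : c = (0, 0).
    have := sqr_eucl (0, 0) c; rewrite c0 /= !sub0r !sqrrN expr0n /=.
    move=> /esym/eqP; rewrite paddr_eq0 ?sqr_ge0// !sqrf_eq0.
    by case: c {sub c0} => u v /= /andP[/eqP-> /eqP->].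
  have er : eucl (0, 0) (r, 0) = r.
    by rewrite /Defs.edist /= !sub0r !sqrrN expr0n addr0 sqrtr_sqr gtr0_norm.
  by move: (sub (r, 0)); rewrite c0 add0r cz /disk /= er; exact.
have cp : 0 < eucl (0, 0) c by rewrite lt_neqAle eq_sym c0 eucl_ge0.
pose k := r / eucl (0, 0) c.
have k0 : 0 < k by rewrite divr_gt0.
have kE : k * eucl (0, 0) c = r by rewrite /k divfK.
have := sub ((1 + k) * c.1, (1 + k) * c.2).
have far : eucl (0, 0) ((1 + k) * c.1, (1 + k) * c.2) = eucl (0, 0) c + r.
  have := eucl_point (1 + k) (0, 0) c; rewrite /= !subr0 !add0r => ->.
  by rewrite gtr0_norm; lra.
have near : eucl c ((1 + k) * c.1, (1 + k) * c.2) = r.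
  rewrite -[RHS]gtr0_norm// -kE normrM (ger0_norm (eucl_ge0 _ _)).
  rewrite -sqrtr_sqr -sqrtrM ?sqr_ge0//; congr Num.sqrt; rewrite /=; ring.
by rewrite /disk /= far near; apply.
Qed.

(** If the centers are closer than [r + r'], the point that cuts the segment
    between them in the ratio [r : r'] is interior to both disks. *)
Lemma interior_disks_disjoint c c' r r' : 0 < r -> 0 < r' ->
  interior (disk c r) `&` interior (disk c' r') = set0 <->
  r + r' <= eucl c c'.
Proof.
move=> r0 r0'; rewrite !interior_diskE//; split => [dis | le].
  rewrite leNgt; apply/negP => lt.
  pose k := r / (r + r').
  have k0 : 0 < k by rewrite divr_gt0 ?addr_gt0.
  have rk : k * (r + r') = r by rewrite /k divfK//; lra.
  pose z := (c.1 + k * (c'.1 - c.1), c.2 + k * (c'.2 - c.2)).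
  suff : [set x | eucl c x < r] z /\ [set x | eucl c' x < r'] z.
    by move=> zz; have : set0 z by rewrite -dis.
  split => /=.
    by rewrite eucl_point gtr0_norm// -[ltRHS]rk ltr_pM2l.
  have -> : z = (c'.1 + (1 - k) * (c.1 - c'.1), c'.2 + (1 - k) * (c.2 - c'.2)).
    by rewrite /z; congr pair; ring.
  have k1 : (1 - k) * (r + r') = r' by rewrite mulrBl rk; lra.
  have k10 : 0 < 1 - k by nra.
  by rewrite eucl_point gtr0_norm// -[ltRHS]k1 eucl_sym ltr_pM2l.
apply/seteqP; split => // x [/= xr xr'].
have := eucl_triangle x c c'; rewrite [eucl x c']eucl_sym; lra.
Qed.

(** From here on a packing is six inequalities between distances. *)
Lemma packs3P (r r' r'' rad : R) : 0 < r -> 0 < r' -> 0 < r'' ->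
  packs [:: r; r'; r''] rad <->
  exists a b c, [/\ eucl (0, 0) a + r <= rad, eucl (0, 0) b + r' <= rad &
                    eucl (0, 0) c + r'' <= rad] /\
    [/\ r + r' <= eucl a b, r + r'' <= eucl a c & r' + r'' <= eucl b c].
Proof.
move=> p0 p0' p0''; split => [[f [sub /trivIsetP dis]] | [a [b [c [[ha hb hc] [ab ac bc]]]]]].
  pose i0 : 'I_3 := @Ordinal 3 0 isT.
  pose i1 : 'I_3 := @Ordinal 3 1 isT.
  pose i2 : 'I_3 := @Ordinal 3 2 isT.
  exists (f i0), (f i1), (f i2); split; split.
  - by apply/subset_disk => //; exact: (sub i0).
  - by apply/subset_disk => //; exact: (sub i1).
  - by apply/subset_disk => //; exact: (sub i2).
  - by apply/interior_disks_disjoint => //; exact: (dis i0 i1).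
  - by apply/interior_disks_disjoint => //; exact: (dis i0 i2).
  - by apply/interior_disks_disjoint => //; exact: (dis i1 i2).
exists (fun i => [:: a; b; c]`_i); split.
  by case=> [[|[|[|//]]] lti] /=; apply/subset_disk.
apply/trivIsetP => -[[|[|[|//]]] lti] [[|[|[|//]]] ltj] _ _ //= _;
  apply/interior_disks_disjoint => //; rewrite eucl_sym// addrC//.
Qed.
End EuclideanDistance.

(** * A unit disk and two smaller disks in a pan of radius 1 + t *)

Section ThreeDisks.
Variable R : realType.
Implicit Types (t p q a u v : R) (P Q : R * R).

(** With the unit disk centered at [(t, 0)], which touches the pan of radius
    [1 + t] internally, this is the center of the disk of radius [p] tangent to
    both, above the axis. *)
Definition corner t p : R * R :=
  (1 + t - p - 2 * p / t, 2 / t * Num.sqrt ((1 + t) * p * (t - p))).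

Definition mirror P : R * R := (P.1, - P.2).

(** Up to the factor [4 / t ^+ 2], the square of the distance between the two
    opposite corners minus the square of [p + q], see [corner_gap]. *)
Definition clearance t p q : R :=
  (1 + t) * (t * (p + q) + 2 * Num.sqrt (p * q * ((t - p) * (t - q)))) -
  p * q * (t ^+ 2 + 2 * t + 2).

Lemma corner_height t p : 0 < t -> 0 < p <= t ->
  (corner t p).2 ^+ 2 = 4 * (1 + t) * p * (t - p) / t ^+ 2.
Proof.
move=> t0 /andP[p0 pt]; rewrite exprMn sqr_sqrtr; first by field; lra.
by rewrite !mulr_ge0 ?subr_ge0//; lra.
Qed.

Lemma corner_tangent_pan t p : 0 < t -> 0 < p <= t ->
  (corner t p).1 ^+ 2 + (corner t p).2 ^+ 2 = (1 + t - p) ^+ 2.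
Proof. by move=> t0 pt; rewrite corner_height//=; field; lra. Qed.

Lemma corner_tangent_unit t p : 0 < t -> 0 < p <= t ->
  (t - (corner t p).1) ^+ 2 + (corner t p).2 ^+ 2 = (1 + p) ^+ 2.
Proof. by move=> t0 pt; rewrite corner_height//=; field; lra. Qed.

Lemma corner_gap t p q : 0 < t -> 0 < p <= t -> 0 < q <= t ->
  eucl (corner t p) (mirror (corner t q)) ^+ 2 =
  (p + q) ^+ 2 + 4 / t ^+ 2 * clearance t p q.
Proof.
move=> t0 pt qt; rewrite sqr_eucl /= opprK [X in _ + X]sqrrD.
have -> : (corner t p).2 * (corner t q).2 =
    4 * (1 + t) / t ^+ 2 * Num.sqrt (p * q * ((t - p) * (t - q))).
  move: pt qt => /andP[p0 pt] /andP[q0 qt] /=.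
  rewrite mulrACA -sqrtrM ?mulr_ge0 ?subr_ge0//; try lra.
  rewrite (_ : _ * _ * (t - p) * _ =
    (1 + t) ^+ 2 * (p * q * ((t - p) * (t - q)))); last ring.
  rewrite sqrtrM ?sqr_ge0// sqrtr_sqr ger0_norm; last lra.
  by field; lra.
rewrite !corner_height// /clearance; set w := Num.sqrt _.
by rewrite /=; field; lra.
Qed.

Lemma packs_at_corners t p q : 0 < t -> 0 < p <= t -> 0 < q <= t ->
  0 <= clearance t p q -> packs [:: 1; p; q] (1 + t).
Proof.
move=> t0 pt qt c0.
have [[p0 pt'] [q0 qt']] := (andP pt, andP qt).
apply/packs3P => //; exists (t, 0), (corner t p), (mirror (corner t q)).
have pan_norm r : 0 < r <= t -> eucl (0, 0) (corner t r) = 1 + t - r.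
  move=> rt; rewrite /Defs.edist !sub0r !sqrrN corner_tangent_pan// sqrtr_sqr.
  by rewrite ger0_norm//; lra.
have unit_norm r : 0 < r <= t -> eucl (t, 0) (corner t r) = 1 + r.
  move=> rt; rewrite /Defs.edist sub0r sqrrN corner_tangent_unit// sqrtr_sqr.
  by rewrite ger0_norm//; lra.
have mirrorE s P : eucl (s, 0) (mirror P) = eucl (s, 0) P.
  by rewrite /Defs.edist /= opprK sub0r sqrrN add0r.
split; split.
- suff : eucl (0, 0) (t, 0) <= t by lra.
  by rewrite (eucl_le _ _ (ltW t0)) /= !sub0r !sqrrN expr0n /= addr0.
- by rewrite pan_norm//; lra.
- by rewrite mirrorE pan_norm//; lra.
- by rewrite unit_norm.
- by rewrite mirrorE unit_norm.
rewrite eucl_ge; last lra.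
rewrite -sqr_eucl corner_gap// lerDl mulr_ge0// divr_ge0//.
by rewrite exprn_ge0// ltW.
Qed.

Lemma packs_mono (r p q p' q' rad : R) : 0 < r -> 0 < p <= p' -> 0 < q <= q' ->
  packs [:: r; p'; q'] rad -> packs [:: r; p; q] rad.
Proof.
move=> r0 /andP[p0 pp] /andP[q0 qq].
move=> /packs3P[]//; try lra; move=> a [b [c [[ha hb hc] [ab ac bc]]]].
by apply/packs3P => //; exists a, b, c; split; split; lra.
Qed.

Lemma corner_left t p : 0 < t -> t * (1 + t) <= p * (2 + t) ->
  (corner t p).1 <= 0.
Proof.
move=> t0 plarge; rewrite -(pmulr_rle0 _ t0).
rewrite (_ : t * _ = t * (1 + t - p) - 2 * p); first lra.
by rewrite /=; field; lra.
Qed.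

(** In the frame of the unit vector [e], with the unit disk centered at [a e],
    the center [P] of a disk of radius [p] is confined to a
    crescent: inside the circle of radius [1 + t - p] around the pan center
    and outside the circle of radius [1 + p] around the unit disk. The bound
    on the abscissa weakens as [a] grows to [t], because
    [1 + t - p <= 1 + p]; at [a = t] it is the abscissa of the corner. As this
    abscissa is nonpositive, the outer circle then bounds the height by that of
    the corner. *)
Lemma crescent t p a (e P : R * R) : 0 < t -> p <= t ->
  t * (1 + t) <= p * (2 + t) -> e.1 ^+ 2 + e.2 ^+ 2 = 1 -> 0 < a <= t ->
  P.1 ^+ 2 + P.2 ^+ 2 <= (1 + t - p) ^+ 2 ->
  (1 + p) ^+ 2 <= (a * e.1 - P.1) ^+ 2 + (a * e.2 - P.2) ^+ 2 ->
  P.1 * e.1 + P.2 * e.2 <= (corner t p).1 /\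
  `|P.2 * e.1 - P.1 * e.2| <= (corner t p).2.
Proof.
move=> t0 pt plarge e1 /andP[a0 at0] inpan apart.
have p0 : 0 < p by nra.
have p2 : t <= 2 * p by nra.
set u := P.1 * e.1 + P.2 * e.2; set v := P.2 * e.1 - P.1 * e.2.
have uv : u ^+ 2 + v ^+ 2 = P.1 ^+ 2 + P.2 ^+ 2.
  by rewrite -[RHS]mulr1 -[in RHS]e1 /u /v; ring.
have au : (a * e.1 - P.1) ^+ 2 + (a * e.2 - P.2) ^+ 2 =
    a ^+ 2 - 2 * a * u + (P.1 ^+ 2 + P.2 ^+ 2).
  have -> : a ^+ 2 = a ^+ 2 * (e.1 ^+ 2 + e.2 ^+ 2) by rewrite e1 mulr1.
  by rewrite /u; ring.
have tX : t * (corner t p).1 = t * (1 + t - p) - 2 * p by rewrite /=; field; lra.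
have X0 := corner_left t0 plarge.
rewrite au in apart; set N := P.1 ^+ 2 + P.2 ^+ 2 in inpan uv apart.
have uX : u <= (corner t p).1.
  rewrite -(ler_pM2l t0) tX.
  suff : 2 * t * u <= t ^+ 2 - ((1 + p) ^+ 2 - N) by lra.
  have K0 : 0 <= (1 + p) ^+ 2 - N by nra.
  rewrite -(ler_pM2l a0); move: K0; set K := _ - N => K0.
  have Ka : t * (2 * a * u) <= t * (a ^+ 2 - K) by rewrite ler_pM2l// /K; lra.
  have Kat : 0 <= (t - a) * (K + t * a) by rewrite mulr_ge0; nra.
  by nra.
split=> //.
have Y0 : 0 <= (corner t p).2 by rewrite mulr_ge0 ?sqrtr_ge0// divr_ge0// ltW.
rewrite -ler_sqr ?nnegrE// real_normK ?num_real//.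
have := @corner_tangent_pan t p t0; rewrite p0 pt => /(_ isT) XY.
have : (corner t p).1 ^+ 2 <= u ^+ 2 by nra.
by lra.
Qed.

(** Conversely, in any packing the centers of the two small disks lie in the
    crescents of [crescent]. With [(u, v)] and [(u', v')] their coordinates in
    the frame used there,
    [|P - Q|^2 = |P|^2 + |Q|^2 - 2 u u' - 2 v v'], and each term on the right is
    largest when [P] and [Q] sit at opposite corners. So the opposite corners
    are at distance at least [p + q]. *)
Lemma clearance_of_packs t p q : 0 < t -> p <= t -> q <= t ->
  t * (1 + t) <= p * (2 + t) -> t * (1 + t) <= q * (2 + t) ->
  packs [:: 1; p; q] (1 + t) -> 0 <= clearance t p q.
Proof.
move=> t0 pt qt plarge qlarge.
have p0 : 0 < p by nra.
have q0 : 0 < q by nra.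
move=> /packs3P[]// A [P [Q [[panA panP panQ] [AP AQ PQ]]]].
pose a := eucl (0, 0) A.
have a0 : 0 < a.
  rewrite lt_neqAle eucl_ge0 andbT eq_sym; apply/eqP => a0.
  have := eucl_triangle (0, 0) A P; rewrite [eucl A (0, 0)]eucl_sym -/a a0.
  suff : t < 2 * p by lra.
  by nra.
pose e := (A.1 / a, A.2 / a).
have aA : A = (a * e.1, a * e.2).
  by rewrite /e /= ![a * _]mulrC !divfK ?gt_eqF//; case: (A).
have e1 : e.1 ^+ 2 + e.2 ^+ 2 = 1.
  have := sqr_eucl (0, 0) A; rewrite -/a /= !sub0r !sqrrN => aa.
  by rewrite !expr_div_n -mulrDl -aa divff// gt_eqF// exprn_gt0.
clearbody e.
have origin r D : r <= t -> eucl (0, 0) D + r <= 1 + t ->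
    D.1 ^+ 2 + D.2 ^+ 2 <= (1 + t - r) ^+ 2.
  move=> rt h; have : eucl (0, 0) D <= 1 + t - r by lra.
  by rewrite eucl_le; [rewrite /= !sub0r !sqrrN | lra].
have at0 : 0 < a <= t by rewrite a0 /=; move: panA; rewrite -/a; lra.
have NP := origin _ _ pt panP; have NQ := origin _ _ qt panQ.
move: AP AQ PQ; rewrite {1 2}aA !eucl_ge; try lra; move=> /= AP AQ PQ.
have [uP vP] := crescent t0 pt plarge e1 at0 NP AP.
have [uQ vQ] := crescent t0 qt qlarge e1 at0 NQ AQ.
have pt' : 0 < p <= t by rewrite p0.
have qt' : 0 < q <= t by rewrite q0.
have XP := corner_left t0 plarge; have XQ := corner_left t0 qlarge.
have TP := corner_tangent_pan t0 pt'; have TQ := corner_tangent_pan t0 qt'.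
have c4 : 0 < 4 / t ^+ 2 by rewrite divr_gt0// exprn_gt0.
rewrite -(pmulr_rge0 _ c4) -(lerD2l ((p + q) ^+ 2)) addr0 -corner_gap// sqr_eucl.
apply: le_trans PQ _.
move: uP vP uQ vQ XP XQ TP TQ; case: (corner t p) => X Y; case: (corner t q) => X' Y'.
rewrite /= opprK => uP vP uQ vQ XP XQ TP TQ.
set u := _ + _ in uP; set v := _ - _ in vP.
set u' := _ + _ in uQ; set v' := _ - _ in vQ.
have -> : (P.1 - Q.1) ^+ 2 + (P.2 - Q.2) ^+ 2 =
    (P.1 ^+ 2 + P.2 ^+ 2) + (Q.1 ^+ 2 + Q.2 ^+ 2) - 2 * (u * u' + v * v').
  have -> : u * u' + v * v' = (P.1 * Q.1 + P.2 * Q.2) * (e.1 ^+ 2 + e.2 ^+ 2).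
    by rewrite /u /u' /v /v'; ring.
  by rewrite e1; ring.
have uu : X * X' <= u * u' by nra.
have vv : - (Y * Y') <= v * v'.
  have : `|v * v'| <= Y * Y' by rewrite normrM ler_pM.
  by rewrite ler_norml => /andP[].
by lra.
Qed.
End ThreeDisks.

(** * The largest sum of radii that always packs *)

Section Snug.
Variable R : realType.
Implicit Types t p q : R.

(** The radius of the two equal disks that fill the gaps left by touching disks
    of radii [1] and [t] in their pan of radius [1 + t], by the circle theorem of
    Descartes. *)
Definition snug t : R := t * (1 + t) / (1 + t + t ^+ 2).

Lemma snugE t : 0 < t -> snug t * (1 + t + t ^+ 2) = t * (1 + t).
Proof. by move=> t0; rewrite /snug divfK//; nra. Qed.

Lemma snug_bounds t : 0 < t -> 0 < snug t <= t.
Proof.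
move=> t0; have st := snugE t0; have t2 := exprn_gt0 2 t0.
apply/andP; split; first by rewrite divr_gt0//; nra.
by nra.
Qed.

(** The extremal case is [p = t] and [q = snug t], with centers [1], [t]
    collinear. Write [s = snug t]. If [p <= s], two disks of radius [s] fit on
    either side of the axis. Otherwise enlarge [q] until [p + q = t + s]: with
    [D = p q - t s] and [m = t ^+ 2 + 2 t + 2], the relation
    [m s = (1 + t) (t + s)] turns the clearance into
    [2 (1 + t) sqrt (p q D) - m D], whose sign is controlled by
    [4 p q <= (t + s) ^+ 2]. *)
Lemma packs_of_sum_le t p q : 0 < t <= 1 -> 0 < q <= p -> p <= t ->
  p + q <= t + snug t -> packs [:: 1; p; q] (1 + t).
Proof.
move=> /andP[t0 t1] /andP[q0 qp] pt pq.
have sE := snugE t0; have /andP[s0 st] := snug_bounds t0.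
move: (snug t) pq sE s0 st => s pq sE s0 st.
have [ps | sp] := leP p s.
  apply: (@packs_mono _ 1 p q s s); rewrite ?ltr01//; try lra.
  apply: packs_at_corners => //; try lra.
  rewrite /clearance (_ : s * s * _ = (s * (t - s)) ^+ 2); last ring.
  rewrite sqrtr_sqr ger0_norm; last by rewrite mulr_ge0 ?subr_ge0// ltW.
  rewrite (_ : _ - _ = s * (4 * t * (1 + t) - s * (t + 2) ^+ 2)); last ring.
  rewrite mulr_ge0 ?subr_ge0 ?(ltW s0)//.
  rewrite -[4 * t * _]mulrA -sE [4 * _]mulrCA ler_pM2l//.
  have := sqr_ge0 t; lra.
apply: (@packs_mono _ 1 p q p (t + s - p)); rewrite ?ltr01//; try lra.
set q' := t + s - p.
apply: packs_at_corners; rewrite /q'//; try lra; rewrite -/q'.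
rewrite /clearance.
have pqD : (t - p) * (t - q') = p * q' - t * s by rewrite /q'; ring.
have D0 : 0 <= p * q' - t * s by rewrite -pqD mulr_ge0 /q'; lra.
have pq'S : 4 * (p * q') <= (t + s) ^+ 2.
  by have := sqr_ge0 (p - q'); rewrite /q'; lra.
have pq'0 : 0 <= p * q' by rewrite mulr_ge0 /q'; lra.
have -> : p + q' = t + s by rewrite /q'; ring.
rewrite pqD; move: (p * q') pq'S D0 pq'0 {pqD} => P PS D0 P0.
set m := t ^+ 2 + 2 * t + 2.
have m0 : 0 < m by rewrite /m; nra.
have msE : m * s = (1 + t) * (t + s) by rewrite /m; lra.
suff : m * (P - t * s) <= 2 * (1 + t) * Num.sqrt (P * (P - t * s)).
  suff : (1 + t) * (t * (t + s)) = m * s * t by lra.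
  by rewrite msE; ring.
have W0 : 0 <= 2 * (1 + t) * Num.sqrt (P * (P - t * s)).
  by rewrite mulr_ge0 ?sqrtr_ge0//; lra.
rewrite -ler_sqr ?nnegrE//; last exact: mulr_ge0 (ltW m0) D0.
rewrite [leLHS]exprMn [leRHS]exprMn sqr_sqrtr; last exact: mulr_ge0.
rewrite [(P - _) ^+ 2]expr2 !mulrA ler_wpM2r//.
(* Because [m ^+ 2 - (2 * (1 + t)) ^+ 2 = (t * (t + 2)) ^+ 2]. *)
suff : P * (t * (t + 2)) ^+ 2 <= m ^+ 2 * (t * s) by rewrite /m; lra.
apply: (@le_trans _ _ ((t + s) ^+ 2 / 4 * (t * (t + 2)) ^+ 2)).
  by rewrite ler_wpM2r ?sqr_ge0//; lra.
have -> : m ^+ 2 * (t * s) = (t + s) * (t * (m * (1 + t))).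
  by transitivity (m * t * (m * s)); [ring | rewrite msE; ring].
have -> : (t + s) ^+ 2 / 4 * (t * (t + 2)) ^+ 2 =
   (t + s) * (t * ((t + s) * t * (t + 2) ^+ 2 / 4)) by field.
rewrite !ler_pM2l//; last lra.
apply: (@le_trans _ _ (2 * t * (t + 2) ^+ 2 / 4)).
  by rewrite ler_wpM2r// ler_wpM2r ?sqr_ge0//; nra.
by rewrite /m; nra.
Qed.

End Snug.

(** * Consequences for the family *)

Section Family.
Variable R : realType.
Implicit Types (t p q w T : R) (I : four_rings R).

Lemma family_sum_gt I : four_ring_family I ->
  r2 I + snug (r2 I) < r3 I + r4 I.
Proof.
case=> _ [t1 pt qp q0] _ [_ _ npack]; rewrite ltNge; apply/negP => le.
by apply: npack; apply: packs_of_sum_le => //; lra.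
Qed.

(** [t + snug t < p + q < 1], and [t + snug t < 1] is this cubic inequality once
    the denominator of [snug t] is cleared. *)
Lemma family_cubic I : four_ring_family I ->
  r2 I ^+ 3 + r2 I ^+ 2 + r2 I < 1.
Proof.
move=> FI; have sum := family_sum_gt FI.
case: FI => _ [t1 pt qp q0] w0 [_ pq _].
have t0 : 0 < r2 I by lra.
have sE := snugE t0; move: sum sE t0 t1; move: (snug _) => s.
move: (r2 I) => t sum sE t0 t1.
have t2 := exprn_gt0 2 t0.
have : (t + s) * (1 + t + t ^+ 2) < 1 * (1 + t + t ^+ 2) by rewrite ltr_pM2r; lra.
by rewrite mulrDl sE; lra.
Qed.

(** [W] is any upper bound of the square root in the clearance, so that concrete
    instances reduce to rational arithmetic. *)
Lemma clearance_lt0 t p q W : 0 < t -> 0 <= W ->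
  p * q * ((t - p) * (t - q)) <= W ^+ 2 ->
  (1 + t) * (t * (p + q) + 2 * W) < p * q * (t ^+ 2 + 2 * t + 2) ->
  clearance t p q < 0.
Proof.
move=> t0 W0 le lt; rewrite subr_lt0; apply: le_lt_trans lt.
rewrite ler_wpM2l; [by []|lra|].
rewrite lerD2l ler_wpM2l//.
by rewrite -[W]ger0_norm// -sqrtr_sqr ler_wsqrtr.
Qed.

Lemma crowded_family t p q w : t < 1 -> 0 < q < p -> p < t ->
  0 < w <= 1 - (p + q) -> t * (1 + t) <= q * (2 + t) -> clearance t p q < 0 ->
  four_ring_family (FourRings 1 t p q w (1 + t)).
Proof.
move=> t1 /andP[q0 qp] pt /andP[w0 wpq] qlarge crowded.
split=> //=; split=> //; first lra.
move=> pk; move: crowded; rewrite ltNge => /negP; apply.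
by apply: clearance_of_packs pk; rewrite ?(ltW pt)//; [lra | lra | nra].
Qed.

(** At the excluded limit [p = t], [q = 1 - t], the clearance is
    [- t * d] with [d] as below, which is negative precisely under the cubic
    inequality. Shrinking [p] by [k ^+ 2] and [q] by [2 * k ^+ 2] makes all
    inequalities strict and costs only [O(k)], because of the square root. *)
Lemma near_tribonacci_family t : 1 / 2 < t -> t ^+ 3 + t ^+ 2 + t < 1 ->
  exists p q w, four_ring_family (FourRings 1 t p q w (1 + t)).
Proof.
move=> th t3.
pose d := 1 - t - t ^+ 2 - t ^+ 3; pose k := t * d / 20.
have d0 : 0 < d by rewrite /d; lra.
have t1 : t < 1 by nra.
have k0 : 0 < k by rewrite /k divr_gt0 ?mulr_gt0//; lra.
have d1 : d < 1 / 2 by rewrite /d; nra.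
have kd : 20 * k = t * d by rewrite /k; field.
have k1 : k < 1 / 40 by nra.
have kk : 0 < k ^+ 2 by rewrite exprn_gt0.
have kk1 : k ^+ 2 < 1 / 1600 by nra.
exists (t - k ^+ 2), (1 - t - 2 * k ^+ 2), (3 * k ^+ 2).
have t1' : t < 3 / 5 by nra.
apply: crowded_family => //; try lra.
  by rewrite -subr_ge0; rewrite /d in d0; nra.
apply: (@clearance_lt0 _ _ _ k); try lra.
  set x := _ * _ * _.
  have -> : x = k ^+ 2 * ((t - k ^+ 2) * (1 - t - 2 * k ^+ 2) * (t - (1 - t - 2 * k ^+ 2))).
    by rewrite /x; ring.
  by rewrite ler_piMr ?sqr_ge0// !mulr_ile1 ?mulr_ge0//; lra.
have kk2 : k ^+ 2 < k / 40 by rewrite expr2; nra.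
set m := t ^+ 2 + 2 * t + 2.
have -> : (t - k ^+ 2) * (1 - t - 2 * k ^+ 2) * m =
    t * (1 + t) + t * d - k ^+ 2 * ((1 + t) * m) + 2 * (k ^+ 2) ^+ 2 * m.
  by rewrite /m /d; ring.
have m10 : 0 < (1 + t) * m <= 10 by rewrite /m; apply/andP; split; nra.
have h1 : k ^+ 2 * ((1 + t) * m) <= k ^+ 2 * 10 by rewrite ler_pM2l//; case/andP: m10.
have h2 : 0 <= 2 * (k ^+ 2) ^+ 2 * m by rewrite mulr_ge0// ?mulr_ge0 ?sqr_ge0// /m; nra.
have h3 : (1 + t) * (2 * k) <= 4 * k by nra.
have h4 : 0 <= (1 + t) * (t * (3 * k ^+ 2)) by rewrite !mulr_ge0//; lra.
by lra.
Qed.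
End Family.

(** * The Tribonacci constant *)

Section Tribonacci.
Variable R : realType.
Implicit Types t T x : R.

Lemma tribonacci_root : exists2 T : R, T ^+ 3 = T ^+ 2 + T + 1 &
  (183 + 929 / 10 ^+ 3) / 10 ^+ 2 - 5 / 10 ^+ 6 <= T
    <= (183 + 929 / 10 ^+ 3) / 10 ^+ 2.
Proof.
pose f : {poly R} := 'X^3 - 'X^2 - 'X - 1.
have fE x : f.[x] = x ^+ 3 - x ^+ 2 - x - 1 by rewrite /f !hornerE.
set b : R := _ / 10 ^+ 2; set a := b - _.
have ab : a <= b by rewrite /a /b; lra.
have fab : f.[a] <= 0 <= f.[b] by rewrite !fE /a /b; apply/andP; split; lra.
have [T TI /rootP] := poly_ivt ab fab.
by rewrite fE => fT; exists T => //; lra.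
Qed.

(** Dividing by [x - T] leaves a quadratic of discriminant
    [5 + 2 T - 3 T ^+ 2], which is negative at the root [T]. *)
Lemma tribonacci_unique T x : 3 / 2 < T -> T ^+ 3 = T ^+ 2 + T + 1 ->
  x ^+ 3 = x ^+ 2 + x + 1 -> x = T.
Proof.
move=> T0 TE xE; apply/eqP; rewrite -subr_eq0.
have : (x - T) * (x ^+ 2 + (T - 1) * x + (T ^+ 2 - T - 1)) = 0.
  transitivity ((x ^+ 3 - x ^+ 2 - x - 1) - (T ^+ 3 - T ^+ 2 - T - 1)); first ring.
  by rewrite xE TE; ring.
move=> /eqP; rewrite mulf_eq0 => /orP[//|/eqP q0].
have := sqr_ge0 (2 * x + (T - 1)).
suff : 5 + 2 * T - 3 * T ^+ 2 < 0 by nra.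
by nra.
Qed.

(** Dividing [T ^+ 3 = T ^+ 2 + T + 1] by [T ^+ 3] shows that [1 / T] is the
    point where the increasing cubic on the left takes the value [1]. *)
Lemma inv_tribonacci T t : 0 < T -> 0 < t -> T ^+ 3 = T ^+ 2 + T + 1 ->
  (t ^+ 3 + t ^+ 2 + t < 1) = (t * T < 1).
Proof.
move=> T0 t0 TE.
rewrite -(ltr_pM2r (exprn_gt0 3 T0)) mul1r [in RHS]mulrC.
have -> : (t ^+ 3 + t ^+ 2 + t) * T ^+ 3 =
    (T * t) ^+ 3 + T * (T * t) ^+ 2 + T ^+ 2 * (T * t) by ring.
have z0 : 0 < T * t by rewrite mulr_gt0.
rewrite TE; move: (T * t) z0 => z z0.
have T2 := exprn_gt0 2 T0.
apply/idP/idP => [lt | z1].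
  by rewrite ltNge; apply/negP => z1; have : 1 <= z ^+ 2 /\ 1 <= z ^+ 3; [split; rewrite exprn_ege1 | case; nra].
have : z ^+ 2 < 1 /\ z ^+ 3 < 1 by split; rewrite exprn_ilt1 ?ltW.
by case; nra.
Qed.

(** [(t + snug t) / t] decreases in [t] and equals [T] at [t = 1 / T]; the cubic
    equation lets the factor [1 - t * T] come out of the difference. *)
Lemma tribonacci_ratio T t : 0 < T < 2 -> T ^+ 3 = T ^+ 2 + T + 1 -> 0 < t ->
  t * T < 1 -> T * t < t + snug t.
Proof.
move=> /andP[T0 T2] TE t0 tT.
have t2 := exprn_gt0 2 t0.
have pos : 0 < 1 + t + t ^+ 2 by lra.
rewrite -(ltr_pM2r pos) mulrDl snugE// -subr_gt0.
have -> : t * (1 + t + t ^+ 2) + t * (1 + t) - T * t * (1 + t + t ^+ 2) =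
    t * (1 - t * T) * ((2 - T) * (1 + (1 + T) * t)) +
    t ^+ 3 * ((T ^+ 2 + T + 1) - T ^+ 3) by ring.
rewrite TE subrr mulr0 addr0 !mulr_gt0 ?subr_gt0//.
by rewrite addr_gt0// mulr_gt0//; lra.
Qed.
End Tribonacci.

(** * The infimum of rho *)

Theorem theorem17 (R : realType) :
  exists T : R,
    (forall x : R, x ^+ 3 = x ^+ 2 + x + 1 <-> x = T) /\
    `|T - (183 + 929 / 10 ^+ 3) / 10 ^+ 2| <= 5 / 10 ^+ 6 /\
    (forall I : four_rings R, four_ring_family I -> T < rho I) /\
    inf [set rho I | I in @four_ring_family R] = T /\
    ~ (exists I : four_rings R, four_ring_family I /\ rho I = T) /\
    (forall I : four_rings R, four_ring_family I -> r2 I < 1 / T) /\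
    four_ring_family (scale_rings (FourRings 10 5 (49 / 10) (48 / 10) (3 / 10) 15 : four_rings R)) /\
    four_ring_family (scale_rings (FourRings 10 5 (499 / 100) (450 / 100) (505 / 1000) 15 : four_rings R)).
Proof.
have [T TE /andP[Tlo Thi]] := tribonacci_root R.
have T32 : 3 / 2 < T by lra.
have T0 : 0 < T by lra.
have gt_rho I : four_ring_family I -> T < rho I.
  move=> FI; have cubic := family_cubic FI; have sum := family_sum_gt FI.
  case: FI => _ [_ pt qp q0] _ _; have t0 : 0 < r2 I by lra.
  rewrite (inv_tribonacci T0 t0 TE) in cubic.
  rewrite !lt_max (ltr_pdivlMr _ _ t0).
  rewrite (lt_trans (tribonacci_ratio _ TE t0 cubic) sum) ?orbT//.
  by rewrite T0; lra.
(* Any [t] below [1 / T] and above both [1 / 2] and [1 / (T + e)] serves: the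
   last bound gives [(p + q) / t < 1 / t < T + e]. *)
have approach (e : R) : 0 < e ->
    exists2 I : four_rings R, four_ring_family I & rho I <= T + e.
  move=> e0.
  pose m := Num.max (1 / 2) (1 / (T + e)).
  have mT : m < 1 / T.
    rewrite gt_max; apply/andP; split; first by rewrite ltr_pdivlMr//; lra.
    by rewrite !div1r ltf_pV2 ?posrE; lra.
  pose t := (m + 1 / T) / 2.
  have mt : m < t by rewrite /t; lra.
  have tT : t < 1 / T by rewrite /t; lra.
  have [th te] : 1 / 2 < t /\ 1 / (T + e) < t.
    by move: mt; rewrite gt_max => /andP[].
  have t0 : 0 < t by lra.
  move: tT te; rewrite ltr_pdivlMr// ltr_pdivrMr; last lra.
  move=> tT te.
  have cubic := tT; rewrite -(inv_tribonacci T0 t0 TE) in cubic.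
  have [p [q [w FI]]] := near_tribonacci_family th cubic.
  exists (FourRings 1 t p q w (1 + t)) => //.
  case: FI => /= _ [t1 pt qp q0] w0 [_ pq _].
  have p0 : 0 < p by lra.
  rewrite rho_scaled !ge_max !ler_pdivrMr//.
  by apply/andP; split; [apply/andP; split|]; nra.
exists T; split; [|split; [|split; [|split; [|split; [|split; [|split]]]]]].
- move=> x; split => [|->//]; exact: tribonacci_unique.
- by rewrite ler_norml; apply/andP; split; lra.
- exact: gt_rho.
- have lbT : lbound [set rho I | I in @four_ring_family R] T.
    by move=> _ [I FI <-]; exact/ltW/gt_rho.
  apply/eqP; rewrite eq_le; apply/andP; split.
    apply/ler_addgt0Pr => e /approach[I FI]; apply: le_trans.
    by apply: ge_inf; [exists T | exists I].
  apply: lb_le_inf => //.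
  by have [I FI _] := approach 1 ltr01; exists (rho I), I.
- by case=> I [/gt_rho TI rT]; rewrite rT ltxx in TI.
- move=> I FI; have := family_cubic FI.
  case: FI => _ [_ pt qp q0] _ _; have t0 : 0 < r2 I by lra.
  by rewrite (inv_tribonacci T0 t0 TE) ltr_pdivlMr.
- have -> : scale_rings (FourRings 10 5 (49 / 10) (48 / 10) (3 / 10) 15 : four_rings R) =
      FourRings 1 (1 / 2) (49 / 100) (48 / 100) (3 / 100) (1 + 1 / 2).
    by rewrite /scale_rings /=; congr FourRings; field.
  (* [7 / 1000] and, below, [34 / 10000] are rational upper bounds of
     [sqrt (p q (t - p) (t - q))]. *)
  apply: crowded_family; try lra.
  by apply: (@clearance_lt0 _ _ _ _ (7 / 1000)); lra.
have -> : scale_rings (FourRings 10 5 (499 / 100) (450 / 100) (505 / 1000) 15 : four_rings R) =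
    FourRings 1 (1 / 2) (499 / 1000) (450 / 1000) (505 / 10000) (1 + 1 / 2).
  by rewrite /scale_rings /=; congr FourRings; field.
apply: crowded_family; try lra.
by apply: (@clearance_lt0 _ _ _ _ (34 / 10000)); lra.
Qed.
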